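(* Let $V$ be a separable left quaternionic Hilbert space, let $\mathfrak{C}\in\mathcal{GL}(V)$ be self-adjoint, and let $\{\phi_k\}_{k\in I}$ be a countable family in $V$. Then $\{\phi_k\}_{k\in I}$ is a frame controlled by $\mathfrak{C}$ if and only if it is a frame in $V$ and $\mathfrak{C}$ is positive and commutes with the frame operator $S$ of $\{\phi_k\}_{k\in I}$.
   Context: $\mathbb{H}$ denotes the quaternions, with conjugation $q\mapsto\overline{q}$. A left quaternionic Hilbert space $V$ is a left $\mathbb{H}$-vector space with an inner product $\langle\cdot|\cdot\rangle:V\times V\to\mathbb{H}$ that is additive in each variable and satisfies $\overline{\langle f|g\rangle}=\langle g|f\rangle$, $\langle f|f\rangle>0$ for $f\ne0$, $\langle qf|g\rangle=q\langle f|g\rangle$, $\langle f|qg\rangle=\langle f|g\rangle\overline{q}$, and is complete for the norm $\|f\|^2=\langle f|f\rangle$. An operator $T$ is left linear if it is additive and $T(qf)=q(Tf)$ for $q\in\mathbb{H}$. The adjoint $T^\dagger$ is defined by $\langle\psi|T\phi\rangle=\langle T^\dagger\psi|\phi\rangle$; $T$ is self-adjoint if $T=T^\dagger$, and positive if $\langle Tf|f\rangle$ is real and $\ge0$ for all $f\in V$. $\mathcal{GL}(V)$ is the set of bounded left linear operators $V\to V$ having a bounded inverse. A countable family $\{\phi_k\}_{k\in I}$ in $V$ is a frame for $V$ if there are constants $A,B>0$ with $A\|\psi\|^2\le\sum_{k\in I}|\langle\psi|\phi_k\rangle|^2\le B\|\psi\|^2$ for all $\psi\in V$; its frame operator is $S:V\to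 V$, $S\psi=\sum_{k\in I}\langle\psi|\phi_k\rangle\phi_k$. For $\mathfrak{C}\in\mathcal{GL}(V)$, a countable family $\{\phi_k\}_{k\in I}$ in $V$ is a frame controlled by $\mathfrak{C}$ if there are constants $0<A_{\mathfrak{C}S}\le B_{\mathfrak{C}S}<\infty$ such that for all $\psi\in V$ $$A_{\mathfrak{C}S}\|\psi\|^2\le\sum_{k\in I}\langle\psi|\phi_k\rangle\langle\mathfrak{C}\phi_k|\psi\rangle\le B_{\mathfrak{C}S}\|\psi\|^2,$$ where the sum is understood to converge to a real number. *)

(* Defs.v *)
From HB Require Import structures.
From mathcomp Require Import all_boot all_order all_algebra finmap.
From mathcomp Require Import ring lra.
From mathcomp Require Import boolp classical_sets functions cardinality reals.
From mathcomp Require Import ereal topology normedtype esum.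
From mathcomp.analysis.showcase Require Import summability.

Set Implicit Arguments.
Unset Strict Implicit.
Unset Printing Implicit Defensive.

Import Order.TTheory GRing.Theory Num.Theory.
Import numFieldNormedType.Exports.

Local Open Scope classical_set_scope.
Local Open Scope ring_scope.

Section QuaternionRing.
Variable R : realType.

(* [Quat a b c d] is a + b i + c j + d k. *)
Record quaternion : Type := Quat { qre : R; qi : R; qj : R; qk : R }.

Definition quat_tuple (q : quaternion) : R * R * R * R :=
  (qre q, qi q, qj q, qk q).
Definition tuple_quat (t : R * R * R * R) : quaternion :=
  let: (a, b, c, d) := t in Quat a b c d.
Lemma quat_tupleK : cancel quat_tuple tuple_quat.
Proof. by case. Qed.

HB.instance Definition _ := Choice.copy quaternion (can_type quat_tupleK).

Definition quat_add (p q : quaternion) : quaternion :=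
  Quat (qre p + qre q) (qi p + qi q) (qj p + qj q) (qk p + qk q).
Definition quat_opp (q : quaternion) : quaternion :=
  Quat (- qre q) (- qi q) (- qj q) (- qk q).
Definition quat_mul (p q : quaternion) : quaternion :=
  let: Quat a b c d := p in
  let: Quat a' b' c' d' := q in
  Quat (a * a' - b * b' - c * c' - d * d')
       (a * b' + b * a' + c * d' - d * c')
       (a * c' - b * d' + c * a' + d * b')
       (a * d' + b * c' - c * b' + d * a').

Fact addqA : associative quat_add.
Proof. by move=> p q r; rewrite /quat_add /= !addrA. Qed.
Fact addqC : commutative quat_add.
Proof.
move=> p q; rewrite /quat_add (addrC (qre p)) (addrC (qi p)) (addrC (qj p)).
by rewrite (addrC (qk p)).
Qed.
Fact add0q : left_id (Quat 0 0 0 0) quat_add.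
Proof. by case=> *; rewrite /quat_add /= !add0r. Qed.
Fact addNq : left_inverse (Quat 0 0 0 0) quat_opp quat_add.
Proof. by case=> *; rewrite /quat_add /= !addNr. Qed.

HB.instance Definition _ :=
  GRing.isZmodule.Build quaternion addqA addqC add0q addNq.

Fact mulqA : associative quat_mul.
Proof. by case=> ? ? ? ? [? ? ? ?] [? ? ? ?]; congr Quat; ring. Qed.
Fact mul1q : left_id (Quat 1 0 0 0) quat_mul.
Proof. by case=> *; congr Quat; ring. Qed.
Fact mulq1 : right_id (Quat 1 0 0 0) quat_mul.
Proof. by case=> *; congr Quat; ring. Qed.
Fact mulqDl : left_distributive quat_mul quat_add.
Proof.
by case=> ? ? ? ? [? ? ? ?] [? ? ? ?]; rewrite /quat_add /=; congr Quat; ring.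
Qed.
Fact mulqDr : right_distributive quat_mul quat_add.
Proof.
by case=> ? ? ? ? [? ? ? ?] [? ? ? ?]; rewrite /quat_add /=; congr Quat; ring.
Qed.
Fact oneq_neq0 : Quat 1 0 0 0 != 0.
Proof. by apply/eqP => -[] /eqP; rewrite oner_eq0. Qed.

HB.instance Definition _ := GRing.Zmodule_isNzRing.Build quaternion
  mulqA mul1q mulq1 mulqDl mulqDr oneq_neq0.

Definition quat_conj (q : quaternion) : quaternion :=
  Quat (qre q) (- qi q) (- qj q) (- qk q).

Definition realq (a : R) : quaternion := Quat a 0 0 0.

Definition quat_scale (a : R) (q : quaternion) : quaternion :=
  Quat (a * qre q) (a * qi q) (a * qj q) (a * qk q).

Fact scaleqA a b q : quat_scale a (quat_scale b q) = quat_scale (a * b) q.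
Proof. by rewrite /quat_scale /= !mulrA. Qed.
Fact scale1q : left_id 1 quat_scale.
Proof. by case=> *; rewrite /quat_scale /= !mul1r. Qed.
Fact scaleqDr : right_distributive quat_scale +%R.
Proof. by move=> a [? ? ? ?] [? ? ? ?]; congr Quat; rewrite /= mulrDr. Qed.
Fact scaleqDl q : {morph quat_scale^~ q : a b / a + b}.
Proof. by case: q => ? ? ? ? a b; congr Quat; rewrite /= mulrDl. Qed.

HB.instance Definition _ := GRing.Zmodule_isLmodule.Build R quaternion
  scaleqA scale1q scaleqDr scaleqDl.

Definition quat_normsq (q : quaternion) : R :=
  qre q ^+ 2 + qi q ^+ 2 + qj q ^+ 2 + qk q ^+ 2.
Definition quat_norm (q : quaternion) : R := Num.sqrt (quat_normsq q).

Fact quat_normsq_ge0 q : 0 <= quat_normsq q.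
Proof. by rewrite /quat_normsq !addr_ge0 ?sqr_ge0. Qed.

Fact ler_normqD p q : quat_norm (p + q) <= quat_norm p + quat_norm q.
Proof.
rewrite -[leRHS]ger0_norm ?addr_ge0 ?sqrtr_ge0// -sqrtr_sqr.
rewrite /quat_norm ler_sqrt ?sqr_ge0// sqrrD !sqr_sqrtr ?quat_normsq_ge0//.
rewrite -sqrtrM ?quat_normsq_ge0//.
pose s := qre p * qre q + qi p * qi q + qj p * qj q + qk p * qk q.
suff hs : s <= Num.sqrt (quat_normsq p * quat_normsq q).
  have -> : quat_normsq (p + q) = quat_normsq p + s *+ 2 + quat_normsq q.
    by rewrite /quat_normsq /s /=; ring.
  by rewrite lerD2r lerD2l lerMn2r.
apply: (le_trans (ler_norm _)); rewrite -sqrtr_sqr.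
rewrite ler_sqrt ?mulr_ge0 ?quat_normsq_ge0// -subr_ge0.
have -> : quat_normsq p * quat_normsq q - s ^+ 2 =
    (qre p * qi q - qi p * qre q) ^+ 2 + (qre p * qj q - qj p * qre q) ^+ 2
  + (qre p * qk q - qk p * qre q) ^+ 2 + (qi p * qj q - qj p * qi q) ^+ 2
  + (qi p * qk q - qk p * qi q) ^+ 2 + (qj p * qk q - qk p * qj q) ^+ 2.
  by rewrite /quat_normsq /s; ring.
by rewrite !addr_ge0 ?sqr_ge0.
Qed.

Fact normqZ (a : R) q : quat_norm (a *: q) = `|a| * quat_norm q.
Proof.
rewrite /quat_norm -sqrtr_sqr -sqrtrM ?sqr_ge0//; congr Num.sqrt.
by rewrite /quat_normsq /=; ring.
Qed.

Fact normq_eq0 q : quat_norm q = 0 -> q = 0.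
Proof.
move/eqP; rewrite sqrtr_eq0 => h.
have {h} : quat_normsq q == 0 by rewrite eq_le h quat_normsq_ge0.
rewrite /quat_normsq !paddr_eq0 ?addr_ge0 ?sqr_ge0// !sqrf_eq0.
by case: q => a b c d /= /andP[/andP[/andP[/eqP-> /eqP->] /eqP->] /eqP->].
Qed.

HB.instance Definition _ := Lmodule_isNormed.Build R quaternion
  ler_normqD normqZ normq_eq0.

End QuaternionRing.

HB.mixin Record Lmodule_isQuatInner (R : realType) V
    & GRing.Lmodule (quaternion R) V := {
  inner : V -> V -> quaternion R;
  innerDl : forall f g h : V, inner (f + g) h = inner f h + inner g h;
  innerDr : forall f g h : V, inner f (g + h) = inner f g + inner f h;
  conj_inner : forall f g : V, quat_conj (inner f g) = inner g f;
  inner_gt0 : forall f : V, f != 0 ->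
    exists2 r : R, 0 < r & inner f f = realq r;
  innerZl : forall (q : quaternion R) (f g : V),
    inner (q *: f) g = q * inner f g;
  innerZr : forall (q : quaternion R) (f g : V),
    inner f (q *: g) = inner f g * quat_conj q
}.

#[short(type="quatInnerType")]
HB.structure Definition QuatInner (R : realType) :=
  {V of GRing.Lmodule (quaternion R) V & Lmodule_isQuatInner R V}.

Definition hnorm (R : realType) (V : quatInnerType R) (f : V) : R :=
  Num.sqrt (qre (inner f f)).

(* [V] itself is a left module over the quaternions, which are not a
   numDomainType, so it cannot be a normedModType.  [realified V] is the same
   additive group, seen as a real vector space normed by [hnorm]; it carries the
   topology of [V]. *)
Definition realified (R : realType) (V : quatInnerType R) : Type := V.

Section Realified.
Variables (R : realType) (V : quatInnerType R).
Implicit Types f g : V.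

HB.instance Definition _ := GRing.Zmodule.on (realified V).

Let scaler (a : R) (f : realified V) : realified V := realq a *: (f : V).

Fact realqM (a b : R) : realq (a * b) = realq a * realq b.
Proof. by congr Quat; rewrite /=; ring. Qed.
Fact realqD (a b : R) : realq (a + b) = realq a + realq b.
Proof. by congr Quat; rewrite /= addr0. Qed.

Let scalerA' a b f : scaler a (scaler b f) = scaler (a * b) f.
Proof. by rewrite /scaler scalerA realqM. Qed.
Let scale1r' : left_id 1 scaler.
Proof. by move=> f; exact: scale1r. Qed.
Let scalerDr' : right_distributive scaler +%R.
Proof. by move=> a f g; exact: scalerDr. Qed.
Let scalerDl' f : {morph scaler^~ f : a b / a + b}.
Proof. by move=> a b; rewrite /scaler realqD; exact: scalerDl. Qed.

HB.instance Definition _ := GRing.Zmodule_isLmodule.Build R (realified V)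
  scalerA' scale1r' scalerDr' scalerDl'.

Let rinner f g : R := qre (inner f g).

Let rinnerDl f g h : rinner (f + g) h = rinner f h + rinner g h.
Proof. by rewrite /rinner innerDl. Qed.
Let rinnerC f g : rinner f g = rinner g f.
Proof. by rewrite /rinner -(conj_inner f g). Qed.
Let rinnerDr f g h : rinner f (g + h) = rinner f g + rinner f h.
Proof. by rewrite /rinner innerDr. Qed.
Let rinnerZl a f g : rinner (realq a *: f) g = a * rinner f g.
Proof. by rewrite /rinner innerZl; case: (inner f g) => * /=; ring. Qed.
Let rinnerZr a f g : rinner f (realq a *: g) = a * rinner f g.
Proof. by rewrite rinnerC rinnerZl rinnerC. Qed.
Let rinner0 f : rinner 0 f = 0.
Proof.
by have := rinnerDl 0 0 f; rewrite addr0 => /eqP; rewrite -subr_eq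
  subrr eq_sym => /eqP.
Qed.
Let rinner_gt0 f : f != 0 -> 0 < rinner f f.
Proof. by move=> /inner_gt0[r r0 e]; rewrite /rinner e. Qed.
Let rinner_ge0 f : 0 <= rinner f f.
Proof.
by have [->|/rinner_gt0/ltW//] := eqVneq f 0; rewrite rinner0.
Qed.

Fact rinner_CauchySchwarz f g : rinner f g ^+ 2 <= rinner f f * rinner g g.
Proof.
have [->|/rinner_gt0 g0] := eqVneq g 0.
  by rewrite rinnerC !rinner0 expr0n mulr0.
have := rinner_ge0 (realq (rinner g g) *: f + realq (- rinner f g) *: g).
rewrite !(rinnerDl, rinnerDr, rinnerZl, rinnerZr) (rinnerC g f) => h.
rewrite -subr_ge0 -(pmulr_rge0 _ g0); apply: (le_trans h).
by rewrite le_eqVlt; apply/orP; left; apply/eqP; ring.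
Qed.

Fact ler_hnormD f g : hnorm (f + g) <= hnorm f + hnorm g.
Proof.
rewrite -[leRHS]ger0_norm ?addr_ge0 ?sqrtr_ge0// -sqrtr_sqr.
rewrite ler_sqrt ?sqr_ge0// sqrrD !sqr_sqrtr ?rinner_ge0//.
rewrite -sqrtrM ?rinner_ge0// -!/(rinner _ _).
rewrite rinnerDl !rinnerDr (rinnerC g f) addrA -(addrA (rinner f f)).
rewrite -mulr2n lerD2r lerD2l lerMn2r.
apply: (le_trans (ler_norm _)); rewrite -sqrtr_sqr.
by rewrite ler_sqrt ?rinner_CauchySchwarz// mulr_ge0 ?rinner_ge0.
Qed.

Fact hnormZ (a : R) f : hnorm (realq a *: f) = `|a| * hnorm f.
Proof.
rewrite /hnorm -!/(rinner _ _) rinnerZl rinnerZr mulrA -expr2.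
by rewrite sqrtrM ?sqr_ge0// sqrtr_sqr.
Qed.

Fact hnorm_eq0 f : hnorm f = 0 -> f = 0.
Proof.
move=> /eqP; rewrite sqrtr_eq0 => h; apply/eqP.
by apply: contraTT h => /rinner_gt0; rewrite -ltNge.
Qed.

HB.instance Definition _ := Lmodule_isNormed.Build R (realified V)
  ler_hnormD hnormZ hnorm_eq0.

End Realified.

HB.mixin Record QuatInner_isComplete (R : realType) V & QuatInner R V := {
  hcauchy_cvg : forall F : set_system (realified V), ProperFilter F ->
    cauchy F -> cvg F
}.

#[short(type="quatHilbertType")]
HB.structure Definition QuatHilbert (R : realType) :=
  {V of QuatInner R V & QuatInner_isComplete R V}.

HB.instance Definition _ (R : realType) (V : quatHilbertType R) :=
  Uniform_isComplete.Build (realified V) hcauchy_cvg.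

Definition separable (T : topologicalType) : Prop :=
  exists2 D : set T, countable D & dense D.

Section Operators.
Variables (R : realType) (V : quatHilbertType R).

Definition bounded_op (T : V -> V) : Prop :=
  exists M : R, forall f : V, hnorm (T f) <= M * hnorm f.

Definition GL : set {linear V -> V} := [set T : {linear V -> V} |
  bounded_op T /\
  exists T' : V -> V, [/\ cancel T T', cancel T' T & bounded_op T']].

Definition is_adjoint (T Tdag : V -> V) : Prop :=
  forall psi phi : V, inner psi (T phi) = inner (Tdag psi) phi.

Definition self_adjoint (T : V -> V) : Prop := is_adjoint T T.

Definition positive_op (T : V -> V) : Prop :=
  forall f : V, exists2 r : R, 0 <= r & inner (T f) f = realq r.

End Operators.

(* Sums over the index set I are unconditional: limits of the finite partial
   sums along the filter [totally]. *)
Section Frames.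
Variables (R : realType) (V : quatHilbertType R) (I : countType).
Variable phi : I -> V.

Definition frame : Prop :=
  exists A B : R, [/\ 0 < A, 0 < B & forall psi : V,
    ((A * hnorm psi ^+ 2)%:E <=
       \esum_(k in [set: I]) (`|inner psi (phi k)| ^+ 2)%:E <=
     (B * hnorm psi ^+ 2)%:E)%E].

(* For a frame the series below converges; [lim] is meaningless otherwise. *)
Definition frame_operator (psi : V) : V :=
  let S : {fset I} -> realified V :=
    partial_sum (fun k => inner psi (phi k) *: phi k) in
  lim (S @ totally).

Definition controlled_frame (C : V -> V) : Prop :=
  exists A B : R, [/\ 0 < A, A <= B & forall psi : V, exists r : R,
    partial_sum (fun k => inner psi (phi k) * inner (C (phi k)) psi) @ totally
      --> realq r
    /\ A * hnorm psi ^+ 2 <= r <= B * hnorm psi ^+ 2].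

End Frames.

(* Main.v *)
Require Import Defs.
From mathcomp Require Import all_boot all_order all_algebra finmap.
From mathcomp Require Import ring lra.
From mathcomp Require Import boolp classical_sets functions cardinality fsbigop reals.
From mathcomp Require Import ereal topology normedtype sequences esum.
From mathcomp.analysis.showcase Require Import summability.

(* Write t_k(f, g) = Re <f|phi_k><phi_k|g>.  If the family is controlled by C,
   polarization over 1 and i shows that \sum_k t_k(f, C g) converges for all f
   and g, to a form which is symmetric because the sums on the diagonal are
   real.  Since C is onto, T(f, g) = \sum_k t_k(f, g) converges too; the bounds on
   T(f, C f) bound T(f, f) on both sides, so the family is a frame, T(f, g) is
   Re <S f|g>, and symmetry of T(f, C g) reads C S = S C.  For the positivity of C,
   put N = 1 - S / b with b an upper bound of S: the operators C S and
   1 - S / (2 b) are positive and commute, so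
     <C f|f> - <C N f|N f> = (2 / b) <C S (1 - S / (2 b)) f|f> >= 0,
   and iterating the contraction N gives <C f|f> >= 0.  Conversely, when C and S
   are positive and commute, the controlled sum is <C S f|f>, which is bounded
   below because the positive operators C and S - a commute.  That a product of
   commuting positive operators is positive follows from F. Riesz's
   decomposition X = \sum_k X_k^2, which avoids square roots. *)

Set Implicit Arguments.
Unset Strict Implicit.
Unset Printing Implicit Defensive.

Import Order.TTheory GRing.Theory Num.Theory.
Import numFieldNormedType.Exports.

Local Open Scope classical_set_scope.
Local Open Scope ring_scope.

#[local] Existing Instance totally_filter.

(** * The real inner product of a quaternionic space *)

Section RealInner.
Variables (R : realType) (V : quatInnerType R).
Implicit Types (f g h : V) (a : R) (X Y : V -> V).

Definition rinner f g : R := qre (inner f g).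

Lemma rinnerDl f g h : rinner (f + g) h = rinner f h + rinner g h.
Proof. by rewrite /rinner innerDl. Qed.

Lemma rinnerC f g : rinner f g = rinner g f.
Proof. by rewrite /rinner -(conj_inner f g). Qed.

Lemma rinnerDr f g h : rinner f (g + h) = rinner f g + rinner f h.
Proof. by rewrite /rinner innerDr. Qed.

Lemma rinnerZl a f g : rinner (realq a *: f) g = a * rinner f g.
Proof. by rewrite /rinner innerZl; case: (inner f g) => * /=; ring. Qed.

Lemma rinnerZr a f g : rinner f (realq a *: g) = a * rinner f g.
Proof. by rewrite rinnerC rinnerZl rinnerC. Qed.

Lemma rinner0l f : rinner 0 f = 0.
Proof. by apply: (addrI (rinner 0 f)); rewrite -rinnerDl !addr0. Qed.

Lemma rinner0r f : rinner f 0 = 0.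
Proof. by rewrite rinnerC rinner0l. Qed.

Lemma rinnerNl f g : rinner (- f) g = - rinner f g.
Proof. by apply: (addrI (rinner f g)); rewrite -rinnerDl !subrr rinner0l. Qed.

Lemma rinnerNr f g : rinner f (- g) = - rinner f g.
Proof. by rewrite rinnerC rinnerNl rinnerC. Qed.

Lemma rinner_gt0 f : f != 0 -> 0 < rinner f f.
Proof. by move=> /inner_gt0[r r0 e]; rewrite /rinner e. Qed.

Lemma rinner_ge0 f : 0 <= rinner f f.
Proof.
by have [->|/rinner_gt0/ltW//] := eqVneq f 0; rewrite rinner0l.
Qed.

Lemma rinner_ext f g : (forall h, rinner f h = rinner g h) -> f = g.
Proof.
move=> e; apply/eqP; rewrite -subr_eq0; apply: contraT => /rinner_gt0.
by rewrite rinnerDl rinnerNl e subrr ltxx.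
Qed.

Lemma hnorm_ge0 f : 0 <= hnorm f.
Proof. exact: sqrtr_ge0. Qed.

Lemma hnorm_sqr f : hnorm f ^+ 2 = rinner f f.
Proof. by rewrite sqr_sqrtr// rinner_ge0. Qed.

Lemma rinner_le f g : `|rinner f g| <= hnorm f * hnorm g.
Proof.
rewrite -ler_sqr ?nnegrE ?mulr_ge0 ?hnorm_ge0//.
by rewrite exprMn !hnorm_sqr real_normK ?num_real// rinner_CauchySchwarz.
Qed.

Lemma bounded_op_sqr X : (exists M, forall f, hnorm (X f) <= M * hnorm f) ->
  exists2 M, 0 < M & forall f, rinner (X f) (X f) <= M * rinner f f.
Proof.
move=> [M XM]; exists (Num.max 1 M ^+ 2).
  by rewrite exprn_gt0// lt_max ltr01.
move=> f; rewrite -!hnorm_sqr -exprMn ler_sqr ?nnegrE ?mulr_ge0 ?hnorm_ge0//.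
  by apply: (le_trans (XM f)); rewrite ler_wpM2r ?hnorm_ge0// le_max lexx orbT.
by rewrite le_max ler01.
Qed.

(** * Symmetric operators and products of commuting positive operators *)

Definition rsym X := forall f g, rinner (X f) g = rinner f (X g).

(** Nondegeneracy of the real inner product makes every symmetric map additive and real-homogeneous,
    so [rsym] can speak of bare functions. *)
Lemma rsymD X : rsym X -> {morph X : f g / f + g}.
Proof.
by move=> sX f g; apply: rinner_ext => h; rewrite rinnerDl !sX rinnerDl.
Qed.

Lemma rsymN X : rsym X -> {morph X : f / - f}.
Proof. by move=> sX f; apply: rinner_ext => h; rewrite rinnerNl !sX rinnerNl. Qed.

Lemma rsymZ X a : rsym X -> {morph X : f / realq a *: f}.
Proof. by move=> sX f; apply: rinner_ext => h; rewrite rinnerZl !sX rinnerZl. Qed.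

(** This rests on X - X^2 = X (1 - X) X + (1 - X) X (1 - X), whose two terms are positive when 0 <=
    X <= 1. *)
Lemma rinner_sub_sqr X f : rsym X ->
  (forall g, 0 <= rinner (X g) g <= rinner g g) ->
  0 <= rinner (X f - X (X f)) f.
Proof.
move=> sX X01.
suff -> : rinner (X f - X (X f)) f =
    (rinner (X f) (X f) - rinner (X (X f)) (X f))
    + rinner (X (f - X f)) (f - X f).
  have /andP[_ XXf] := X01 (X f); have /andP[Xfg _] := X01 (f - X f).
  by rewrite addr_ge0 ?subr_ge0.
rewrite (rsymD sX) (rsymN sX) !(rinnerDl, rinnerDr, rinnerNl, rinnerNr).
by rewrite !(sX (X f) f); ring.
Qed.

(** After division by [M] this is Y^2 <= Y for an operator Y between 0 and 1. *)
Lemma rsym_sqr_le X (M : R) f : rsym X -> 0 < M ->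
  (forall g, 0 <= rinner (X g) g <= M * rinner g g) ->
  rinner (X f) (X f) <= M * rinner (X f) f.
Proof.
move=> sX M0 XM; pose Y g := realq M^-1 *: X g.
have sY : rsym Y by move=> g h; rewrite rinnerZl sX rinnerZr.
have Y01 g : 0 <= rinner (Y g) g <= rinner g g.
  have /andP[X0 X1] := XM g.
  by rewrite rinnerZl mulr_ge0 ?invr_ge0 ?(ltW M0)//= ler_pdivrMl.
have := rinner_sub_sqr f sY Y01.
rewrite rinnerDl rinnerNl (sY (Y f)) subr_ge0 /Y !(rinnerZl, rinnerZr).
by rewrite ler_pM2l ?invr_gt0// ler_pdivrMl.
Qed.

(* F. Riesz: the operators X_(k+1) := X_k - X_k^2 stay between 0 and 1, and
   X_0 = \sum_(k < n) X_k^2 + X_n; [eps] bounds every [|X_k f|^2] from below. *)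
Lemma riesz_iteration Y f (c eps : R) : rsym Y -> (forall g, 0 <= rinner (Y g) g) ->
  c < 0 -> c ^+ 2 = eps * rinner (Y f) (Y f) ->
  forall n X, rsym X -> (forall g, 0 <= rinner (X g) g <= rinner g g) ->
  (forall g, Y (X g) = X (Y g)) -> rinner (Y (X f)) f <= c ->
  n%:R * eps <= rinner (X f) f.
Proof.
move=> sY Y0 c0 ce; elim=> [X _ X01 _ _|n IHn X sX X01 XY Xc].
  by rewrite mul0r; case/andP: (X01 f).
(* Since <Y X f|f> <= c < 0, Cauchy-Schwarz gives c^2 <= <X f|Y f>^2 <= |X f|^2 |Y f|^2. *)
have eX : eps <= rinner (X f) (X f).
  have cX : c ^+ 2 <= rinner (X f) (X f) * rinner (Y f) (Y f).
    apply: (@le_trans _ _ (rinner (X f) (Y f) ^+ 2)).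
      rewrite -sY -[leLHS]sqrrN -[leRHS]sqrrN ler_sqr ?nnegrE ?oppr_ge0 ?lerN2//.
        exact: ltW.
      exact: le_trans Xc (ltW c0).
    exact: rinner_CauchySchwarz.
  have Yf0 : 0 < rinner (Y f) (Y f).
    rewrite lt0r rinner_ge0 andbT; apply: contraTneq cX => ->.
    by rewrite mulr0 -ltNge exprn_even_gt0//= lt_eqF.
  by move: cX; rewrite ce ler_pM2r.
have sX' : rsym (fun g => X g - X (X g)).
  by move=> g h; rewrite rinnerDl rinnerNl !sX rinnerDr rinnerNr.
have := IHn (fun g => X g - X (X g)) sX'.
rewrite /= -natr1 mulrDl mul1r -lerBrDr => IH.
apply: le_trans (IH _ _ _) _.
- move=> g; rewrite rinner_sub_sqr//= rinnerDl rinnerNl (sX (X g)).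
  have /andP[_ /(le_trans _)] := X01 g; apply.
  by rewrite gerBl rinner_ge0.
- by move=> g; rewrite (rsymD sY) (rsymN sY) !XY.
(* The bound by [c] survives the passage to X - X^2, because <Y X^2 f|f> = <Y X f|X f> >= 0. *)
- apply: le_trans Xc; rewrite (rsymD sY) (rsymN sY) rinnerDl rinnerNl gerBl.
  by rewrite XY sX Y0.
- by rewrite rinnerDl rinnerNl (sX (X f)) lerD2l lerN2.
Qed.

(** If c = <Y X f|f> were negative, Y f would be nonzero by Cauchy-Schwarz, and the iteration would
    give n eps <= <X f|f> for every n with a fixed eps > 0, against the Archimedean property. *)
Lemma mul_rpos X Y : rsym X -> rsym Y ->
  (forall g, 0 <= rinner (X g) g <= rinner g g) ->
  (forall g, 0 <= rinner (Y g) g) ->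
  (forall g, Y (X g) = X (Y g)) ->
  forall f, 0 <= rinner (Y (X f)) f.
Proof.
move=> sX sY X01 Y0 XY f; rewrite leNgt; apply/negP => c0.
set c := rinner _ _ in c0.
have Yf0 : 0 < rinner (Y f) (Y f).
  have := rinner_CauchySchwarz (X f) (Y f); rewrite -!/(rinner _ _) -sY -/c.
  by rewrite lt0r rinner_ge0 andbT; apply: contraTneq => ->;
    rewrite mulr0 -ltNge exprn_even_gt0//= lt_eqF.
pose eps := c ^+ 2 / rinner (Y f) (Y f).
have eps0 : 0 < eps by rewrite divr_gt0// exprn_even_gt0//= lt_eqF.
have h n : n%:R * eps <= rinner (X f) f.
  have ce : c ^+ 2 = eps * rinner (Y f) (Y f) by rewrite /eps divfK// gt_eqF.
  exact: (riesz_iteration sY Y0 c0 ce n sX X01 XY (lexx c)).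
have /andP[Xf0 _] := X01 f.
have := archi_boundP (divr_ge0 Xf0 (ltW eps0)).
by rewrite ltr_pdivrMr// ltNge h.
Qed.

(** Positivity of products is applied to X / M, which lies between 0 and 1, and to Y - a. *)
Lemma mul_rge X Y (a M : R) : rsym X -> rsym Y -> 0 < M ->
  (forall g, 0 <= rinner (X g) g <= M * rinner g g) ->
  (forall g, a * rinner g g <= rinner (Y g) g) ->
  (forall g, Y (X g) = X (Y g)) ->
  forall f, a * rinner (X f) f <= rinner (Y (X f)) f.
Proof.
move=> sX sY M0 XM Ya XY f.
pose X' g := realq M^-1 *: X g; pose Y' g := Y g - realq a *: g.
have : 0 <= rinner (Y' (X' f)) f.
  apply: mul_rpos.
  - by move=> g h; rewrite rinnerZl sX rinnerZr.
  - by move=> g h; rewrite rinnerDl rinnerNl sY rinnerZl rinnerDr rinnerNr rinnerZr.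
  - move=> g; rewrite rinnerZl mulr_ge0 ?invr_ge0 ?(ltW M0)//=; last first.
      by case/andP: (XM g).
    by rewrite mulrC ler_pdivrMr// mulrC; case/andP: (XM g).
  - by move=> g; rewrite rinnerDl rinnerNl rinnerZl subr_ge0.
  - by move=> g; rewrite /Y' /X' (rsymZ _ sY) (rsymD sX) (rsymN sX) (rsymZ _ sX) XY
      scalerBr !scalerA -!realqM mulrC.
rewrite /Y' /X' (rsymZ _ sY) scalerA -realqM mulrC realqM -scalerA -scalerBr.
by rewrite rinnerZl pmulr_rge0 ?invr_gt0// rinnerDl rinnerNl rinnerZl subr_ge0.
Qed.

Lemma rpos_of_mul C S (a b M : R) : rsym C -> rsym S -> 0 < a -> 0 < b -> 0 < M ->
  (forall g, a * rinner g g <= rinner (S g) g <= b * rinner g g) ->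
  (forall g, - M * rinner g g <= rinner (C g) g) ->
  (forall g, C (S g) = S (C g)) ->
  (forall g, 0 <= rinner (C (S g)) g) ->
  forall f, 0 <= rinner (C f) f.
Proof.
move=> sC sS a0 b0 M0 Sab CM CS CS0 f.
(* A nonzero vector yields [a <= b], hence [0 <= q]. *)
have [->|/rinner_gt0 f0] := eqVneq f 0; first by rewrite rinner0r.
have ab : a <= b by have /andP[+ /(le_trans _)] := Sab f => /[swap]/[apply];
  rewrite ler_pM2r.
pose q := 1 - b^-1 * a.
have q0 : 0 <= q by rewrite subr_ge0 mulrC ler_pdivrMr// mul1r.
(* [U b^-1] is the contraction that gets iterated, and [U (b^-1 / 2)] is the factor 1 - S / (2 b) of
   the descent identity; both lie between 0 and 1. *)
pose U (t : R) g := g - realq t *: S g.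
have sU t : rsym (U t).
  by move=> g h; rewrite rinnerDl rinnerNl rinnerZl sS rinnerDr rinnerNr rinnerZr.
have U01 t g : 0 <= t <= b^-1 -> 0 <= rinner (U t g) g <= rinner g g.
  move=> /andP[t0 tb]; rewrite rinnerDl rinnerNl rinnerZl.
  have /andP[Sa Sb] := Sab g; have g0 := rinner_ge0 g.
  rewrite subr_ge0 gerBl mulr_ge0 ?andbT//; last first.
    by rewrite (le_trans _ Sa)// mulr_ge0// ltW.
  rewrite (le_trans (ler_wpM2l t0 Sb))// mulrA -[leRHS]mul1r ler_wpM2r//.
  by rewrite -ler_pdivlMr// mul1r.
have b01 : 0 <= b^-1 <= b^-1 by rewrite lexx invr_ge0 ltW.
have h01 : 0 <= b^-1 / 2 <= b^-1.
  by rewrite divr_ge0 ?invr_ge0 ?(ltW b0)//= ler_piMr ?invr_ge0 ?(ltW b0)//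
    invf_le1// ler1n.
have CSU g : 0 <= rinner (C (S (U (b^-1 / 2) g))) g.
  apply: (@mul_rpos (U (b^-1 / 2)) (fun h => C (S h))) => //.
  - by move=> h k; rewrite sC sS CS.
  - by move=> h; exact: U01.
  - move=> h; rewrite /U.
    by rewrite !(rsymD sC, rsymD sS, rsymN sC, rsymN sS, rsymZ _ sC, rsymZ _ sS) -CS.
have descent g : rinner (C (U b^-1 g)) (U b^-1 g) <= rinner (C g) g.
  have := CSU g; rewrite /U.
  rewrite !(rsymD sC, rsymD sS, rsymN sC, rsymN sS, rsymZ _ sC, rsymZ _ sS).
  rewrite !(rinnerDl, rinnerDr, rinnerNl, rinnerNr, rinnerZl, rinnerZr).
  rewrite [rinner (C g) (S g)]rinnerC sS -CS [rinner g _]rinnerC.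
  rewrite [rinner (C (S g)) (S g)]rinnerC sS -!CS [rinner g _]rinnerC.
  move=> h; rewrite -subr_ge0.
  have : 0 <= 2 * b^-1 * (rinner (C (S g)) g - b^-1 / 2 * rinner (C (S (S g))) g).
    by rewrite mulr_ge0// mulr_ge0 ?invr_ge0 ?ltW.
  by move/le_trans; apply; rewrite le_eqVlt; apply/orP; left; apply/eqP; field;
    rewrite gt_eqF.
(* With N = 1 - S / b, this is N^2 <= N <= 1 - a / b. *)
have contr g : rinner (U b^-1 g) (U b^-1 g) <= q * rinner g g.
  have := rinner_sub_sqr g (sU b^-1) (fun h => U01 _ h b01).
  rewrite rinnerDl rinnerNl (sU _ (U _ _)) subr_ge0 => /le_trans; apply.
  rewrite rinnerDl rinnerNl rinnerZl /q mulrBl mul1r lerD2l lerN2 -mulrA.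
  by rewrite ler_wpM2l ?invr_ge0 ?(ltW b0)//; case/andP: (Sab g).
(* Each descent step replaces g by N g, whose squared norm is at most [q] times that of g, so the
   lower bound -M improves by a factor [q]. *)
have lb n : forall g, - (M * q ^+ n) * rinner g g <= rinner (C g) g.
  elim: n => [|n IHn] g; first by rewrite expr0 mulr1.
  apply: le_trans (descent g); apply: le_trans (IHn _).
  rewrite !mulNr lerN2 exprSr mulrA -[leRHS]mulrA ler_wpM2l//.
  by rewrite mulr_ge0 ?exprn_ge0// ltW.
have q1 : `|q| < 1.
  by rewrite ger0_norm// gtrBl mulr_gt0// invr_gt0.
rewrite leNgt; apply/negP => c0.
pose e := - rinner (C f) f / (M * rinner f f).
have e0 : 0 < e by rewrite divr_gt0 ?oppr_gt0// mulr_gt0.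
have /cvgrPdist_lt/(_ _ e0)[n _ /(_ n (leqnn n))] := cvg_expr q1.
rewrite /= sub0r normrN ger0_norm ?exprn_ge0// ltr_pdivlMr ?mulr_gt0//.
by rewrite ltNge lerNl mulrA [_ * M]mulrC -mulNr lb.
Qed.
End RealInner.

(** * Unconditional sums along finite subsets *)

Section PartialSums.
Variable I : choiceType.

Lemma partial_sumE (W : zmodType) (x : I -> W) (A : {fset I}) :
  partial_sum x A = \sum_(i <- A) x i.
Proof. by rewrite big_seq_fsetE. Qed.

Lemma partial_sum_split (W : zmodType) (x : I -> W) (A J : {fset I}) :
  (A `<=` J)%fset -> partial_sum x J = partial_sum x A + partial_sum x (J `\` A)%fset.
Proof.
move=> AJ; rewrite !partial_sumE (big_fsetID _ (mem A))/=; congr (_ + _).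
  congr (\sum_(i <- enum_fset _) _); apply/fsetP => i; rewrite !inE/= andbC.
  by apply: andb_idr; exact: (fsubsetP AJ).
by congr (\sum_(i <- enum_fset _) _); apply/fsetP => i; rewrite !inE/= andbC.
Qed.

Lemma partial_sum_morph (W W' : zmodType) (g : W -> W') (x : I -> W) A :
  g 0 = 0 -> {morph g : u v / u + v} ->
  g (partial_sum x A) = partial_sum (g \o x) A.
Proof. by move=> g0 gD; rewrite /partial_sum (big_morph g gD g0). Qed.

Lemma cvg_partial_sum_morph (R : realType) (W W' : normedModType R) (g : W -> W')
    (M : R) (x : I -> W) (l : W) :
  {morph g : u v / u + v} -> (forall u, `|g u| <= M * `|u|) ->
  partial_sum x @ totally --> l -> partial_sum (g \o x) @ totally --> g l.
Proof.
move=> gD gM xl.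
have g0 : g 0 = 0 by apply: (addrI (g 0)); rewrite -gD !addr0.
have gN u : g (- u) = - g u by apply: (addrI (g u)); rewrite -gD !subrr.
have -> : partial_sum (g \o x) = g \o partial_sum x.
  by apply/funext => A; rewrite /= partial_sum_morph.
apply/cvgrPdist_lt => e e0.
(* The constant [M] may be zero or negative, so the division uses [|M| + 1]. *)
have M0 : 0 < `|M| + 1 by rewrite ltr_wpDl.
have /cvgrPdist_lt/(_ _ (divr_gt0 e0 M0)) := xl.
apply: filterS => A /=; rewrite ltr_pdivlMr// => h.
rewrite -gN -gD (le_lt_trans (gM _))// (le_lt_trans _ h)// mulrC ler_wpM2l//.
by rewrite (le_trans (ler_norm _))// lerDl.
Qed.

Section RealSums.
Variable R : realType.
Implicit Types (x y a : I -> R) (l m c : R).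

Lemma cvg_partial_sumD x y l m :
  partial_sum x @ totally --> l -> partial_sum y @ totally --> m ->
  partial_sum (fun k => x k + y k) @ totally --> l + m.
Proof.
move=> xl ym.
have -> : partial_sum (fun k => x k + y k) = partial_sum x + partial_sum y.
  by apply/funext => A; rewrite /partial_sum big_split.
exact: cvgD.
Qed.

Lemma cvg_partial_sumZ c x l :
  partial_sum x @ totally --> l ->
  partial_sum (fun k => c * x k) @ totally --> c * l.
Proof.
move=> xl; apply: (cvg_partial_sum_morph (mulrDr c) _ xl) => u.
by rewrite normrM.
Qed.

Lemma cvg_partial_sumB x y l m :
  partial_sum x @ totally --> l -> partial_sum y @ totally --> m ->
  partial_sum (fun k => x k - y k) @ totally --> l - m.
Proof.
move=> xl ym.
have -> : partial_sum (fun k => x k - y k) = partial_sum x - partial_sum y.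
  by apply/funext => A; rewrite /partial_sum sumrB.
exact: cvgB.
Qed.

Lemma cvg_partial_sum_unique x l m :
  partial_sum x @ totally --> l -> partial_sum x @ totally --> m -> l = m.
Proof. exact: norm_cvg_unique. Qed.

Lemma partial_sum_ge0 a A : (forall k, 0 <= a k) -> 0 <= partial_sum a A.
Proof. by move=> a0; apply: sumr_ge0. Qed.

Lemma ler_partial_sum a A J :
  (forall k, 0 <= a k) -> (A `<=` J)%fset -> partial_sum a A <= partial_sum a J.
Proof.
by move=> a0 AJ; rewrite (partial_sum_split _ AJ) lerDl partial_sum_ge0.
Qed.

Lemma esum_partial_sum a : (forall k, 0 <= a k) ->
  \esum_(k in [set: I]) (a k)%:E =
  ereal_sup [set (partial_sum a A)%:E | A in [set: {fset I}]].
Proof.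
move=> a0; congr ereal_sup; apply/seteqP; split => [_ [X [finX _] <-]|_ [A _ <-]].
  exists (fset_set X) => //.
  by rewrite partial_sumE fsbig_finite//= sumEFin.
exists [set` A]; first by split.
by rewrite partial_sumE fsbig_finite//= set_fsetK sumEFin.
Qed.

Lemma partial_sum_le_cvg a l A : (forall k, 0 <= a k) ->
  partial_sum a @ totally --> l -> partial_sum a A <= l.
Proof.
move=> a0 al; apply: (cvgr_to_ge al).
by exists A => // J /=; exact: ler_partial_sum.
Qed.

Lemma cvg_partial_sum_ge0 a l : (forall k, 0 <= a k) ->
  partial_sum a @ totally --> l -> 0 <= l.
Proof.
by move=> a0 /(partial_sum_le_cvg fset0 a0); apply: le_trans; exact: partial_sum_ge0.
Qed.

(** The partial sums form a monotone net, which converges to its supremum. *)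
Lemma esum_cvg_partial_sum a l : (forall k, 0 <= a k) ->
  \esum_(k in [set: I]) (a k)%:E = l%:E -> partial_sum a @ totally --> l.
Proof.
move=> a0; rewrite esum_partial_sum// => al; apply/cvgrPdist_lt => e e0.
have : ((l - e)%:E < ereal_sup [set (partial_sum a A)%:E | A in [set: {fset I}]])%E.
  by rewrite al lte_fin gtrBl.
move=> /ereal_sup_gt[_ [A _ <-]]; rewrite lte_fin => lA.
exists A => // J /= /(ler_partial_sum a0) AJ.
have Jl : partial_sum a J <= l.
  by rewrite -lee_fin -al; apply: ereal_sup_ubound; exists J.
by rewrite ger0_norm ?subr_ge0//; lra.
Qed.

(** The limit bounds all partial sums, so the supremum is finite; it is then itself a limit, and
    limits are unique. *)
Lemma cvg_partial_sum_esum a l : (forall k, 0 <= a k) ->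
  partial_sum a @ totally --> l -> \esum_(k in [set: I]) (a k)%:E = l%:E.
Proof.
move=> a0 al.
have ub : (\esum_(k in [set: I]) (a k)%:E <= l%:E)%E.
  rewrite esum_partial_sum//; apply: ge_ereal_sup => _ [A _ <-].
  by rewrite lee_fin partial_sum_le_cvg.
have lb : (0 <= \esum_(k in [set: I]) (a k)%:E)%E.
  by apply: esum_ge0 => k _; rewrite lee_fin.
case E : (\esum_(k in [set: I]) (a k)%:E) ub lb => [m| |]// _ _; congr EFin.
exact: cvg_partial_sum_unique (esum_cvg_partial_sum a0 E) al.
Qed.

End RealSums.
End PartialSums.

(** * Quaternion norm, conjugation and components *)

Section QuaternionFacts.
Variable R : realType.
Implicit Types p q : quaternion R.

Lemma quat_norm_sqr q : `|q| ^+ 2 = quat_normsq q.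
Proof. by rewrite sqr_sqrtr// quat_normsq_ge0. Qed.

Lemma qre_norm q : `|qre q| <= `|q|.
Proof.
rewrite -ler_sqr ?nnegrE// quat_norm_sqr real_normK ?num_real//.
by rewrite /quat_normsq -!addrA lerDl !addr_ge0 ?sqr_ge0.
Qed.

Lemma qi_norm q : `|qi q| <= `|q|.
Proof.
rewrite -ler_sqr ?nnegrE// quat_norm_sqr real_normK ?num_real//.
have := (sqr_ge0 (qre q), sqr_ge0 (qj q), sqr_ge0 (qk q)).
by rewrite /quat_normsq => -[[]]; lra.
Qed.

Lemma quat_conj_norm q : `|quat_conj q| = `|q|.
Proof. by congr Num.sqrt; rewrite /quat_normsq /= !sqrrN. Qed.

Lemma quat_conjD p q : quat_conj (p + q) = quat_conj p + quat_conj q.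
Proof. by congr Quat; rewrite /= opprD. Qed.

Lemma quat_conjM p q : quat_conj (p * q) = quat_conj q * quat_conj p.
Proof. by case: p q => ? ? ? ? [? ? ? ?]; congr Quat => /=; ring. Qed.

Lemma quat_conjK : involutive (@quat_conj R).
Proof. by case=> ? ? ? ?; rewrite /quat_conj /= !opprK. Qed.

Lemma quat_conj_real q : quat_conj q = q -> q = realq (qre q).
Proof. by case: q => a b c d [] hb hc hd; congr Quat; lra. Qed.

Lemma qreM_conj q : qre (q * quat_conj q) = `|q| ^+ 2.
Proof. by rewrite quat_norm_sqr; case: q => ? ? ? ?; rewrite /quat_normsq/=; ring. Qed.

Lemma qreMC p q : qre (p * q) = qre (q * p).
Proof. by case: p q => ? ? ? ? [? ? ? ?] /=; ring. Qed.

Lemma qreM_conjC p q : qre (p * quat_conj q) = qre (q * quat_conj p).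
Proof. by case: p q => ? ? ? ? [? ? ? ?] /=; ring. Qed.

(** Young's inequality, from s^-1 |s p - q|^2 >= 0. *)
Lemma qreM_conj_le p q (s : R) : 0 < s ->
  2 * qre (p * quat_conj q) <= s * `|p| ^+ 2 + s^-1 * `|q| ^+ 2.
Proof.
move=> s0; rewrite !quat_norm_sqr -subr_ge0.
case: p q => a b c d [a' b' c' d']; rewrite /quat_normsq/=.
rewrite [leRHS](_ : _ = s^-1 * ((s * a - a') ^+ 2 + (s * b - b') ^+ 2 +
   (s * c - c') ^+ 2 + (s * d - d') ^+ 2)).
  by rewrite mulr_ge0 ?invr_ge0 ?(ltW s0)// !addr_ge0 ?sqr_ge0.
by field; rewrite gt_eqF.
Qed.

End QuaternionFacts.

Section QuaternionSums.
Variables (R : realType) (I : choiceType) (x : I -> quaternion R) (l : quaternion R).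
Hypothesis xl : partial_sum x @ totally --> l.

Lemma cvg_qre : partial_sum (fun k => qre (x k)) @ totally --> qre l.
Proof.
apply: (@cvg_partial_sum_morph I R _ _ (@qre R) 1 _ _ _ _ xl) => // q.
by rewrite mul1r qre_norm.
Qed.

Lemma cvg_qi : partial_sum (fun k => qi (x k)) @ totally --> qi l.
Proof.
apply: (@cvg_partial_sum_morph I R _ _ (@qi R) 1 _ _ _ _ xl) => // q.
by rewrite mul1r qi_norm.
Qed.

Lemma cvg_quat_conj :
  partial_sum (fun k => quat_conj (x k)) @ totally --> quat_conj l.
Proof.
apply: (@cvg_partial_sum_morph I R _ _ (@quat_conj R) 1 _ _ _ _ xl).
  exact: quat_conjD.
by move=> q; rewrite mul1r quat_conj_norm.
Qed.

End QuaternionSums.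

(** * Quaternionic Cauchy-Schwarz and the synthesis bound *)

Section InnerSums.
Variables (R : realType) (V : quatInnerType R) (I : choiceType).
Implicit Types (f g h : V) (phi : I -> V) (c : I -> quaternion R).

Lemma norm_realified f : `|f : realified V| = hnorm f.
Proof. by []. Qed.

(** With q = <f|g>, the real Cauchy-Schwarz inequality is applied to the rotated and scaled vector
    conj(q) f, whose inner product with g has real part |q|^2. *)
Lemma inner_norm f g : `|inner f g| <= hnorm f * hnorm g.
Proof.
set q := inner f g.
have [q0|] := eqVneq `|q| 0; first by rewrite q0 mulr_ge0 ?hnorm_ge0.
rewrite -normr_gt0 normr_id => q0.
have qf : hnorm (quat_conj q *: f) = `|q| * hnorm f.
  apply/eqP; rewrite -(@eqrXn2 _ 2)// ?mulr_ge0 ?hnorm_ge0// exprMn !hnorm_sqr.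
  rewrite /rinner innerZl innerZr quat_conjK quat_norm_sqr.
  rewrite (quat_conj_real (conj_inner f f)); apply/eqP.
  by case: (q) => *; rewrite /quat_normsq/=; ring.
have := rinner_le (quat_conj q *: f) g.
rewrite /rinner innerZl -/q qreMC qreM_conj qf ger0_norm ?sqr_ge0//.
by rewrite expr2 -mulrA ler_pM2l.
Qed.

Lemma cvg_inner (x : I -> realified V) (l : realified V) h :
  partial_sum x @ totally --> l ->
  partial_sum (fun k => inner (x k : V) h) @ totally --> inner (l : V) h.
Proof.
apply: (@cvg_partial_sum_morph I R _ _ (fun f : realified V => inner (f : V) h)
  (hnorm h)).
  by move=> f g; exact: innerDl.
by move=> f; rewrite mulrC; exact: inner_norm.
Qed.

(** This is dual to Bessel's inequality: for v = \sum_k c_k phi_k, Young's inequality with s = B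
    bounds 2 |v|^2 by B \sum_k |c_k|^2 + B^-1 \sum_k |<v|phi_k>|^2, and the last term is at most
    |v|^2. *)
Lemma bessel_partial_sum phi (B : R) c (J : {fset I}) : 0 < B ->
  (forall f, partial_sum (fun k => `|inner f (phi k)| ^+ 2) J <= B * rinner f f) ->
  hnorm (partial_sum (fun k => c k *: phi k) J) ^+ 2 <=
  B * partial_sum (fun k => `|c k| ^+ 2) J.
Proof.
move=> B0 bessel; set v := partial_sum _ J; rewrite hnorm_sqr.
have vv : rinner v v = partial_sum (fun k => qre (c k * quat_conj (inner v (phi k)))) J.
  rewrite {1}/v (@partial_sum_morph _ _ _ (fun f => rinner f v)) ?rinner0l//.
    congr partial_sum; apply/funext => k /=.
    by rewrite /rinner innerZl conj_inner.
  by move=> f g; rewrite rinnerDl.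
have : 2 * rinner v v <= B * partial_sum (fun k => `|c k| ^+ 2) J
    + B^-1 * partial_sum (fun k => `|inner v (phi k)| ^+ 2) J.
  rewrite {1}vv /partial_sum !mulr_sumr -big_split; apply: ler_sum => k _ /=.
  exact: qreM_conj_le.
have : B^-1 * partial_sum (fun k => `|inner v (phi k)| ^+ 2) J <= rinner v v.
  by rewrite mulrC ler_pdivrMr// mulrC.
lra.
Qed.

End InnerSums.

(** * Convergence, symmetry and bounds of the frame operator *)

Section FrameOperator.
Variables (R : realType) (V : quatHilbertType R) (I : countType) (phi : I -> V).
Implicit Types f g h : V.

Lemma frame_operator_cvg (B : R) f : 0 < B ->
  (forall g, (\esum_(k in [set: I]) (`|inner g (phi k)| ^+ 2)%:E <=
    (B * hnorm g ^+ 2)%:E)%E) ->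
  (partial_sum (fun k => inner f (phi k) *: phi k) : {fset I} -> realified V)
    @ totally --> (frame_operator phi f : realified V).
Proof.
move=> B0 frB.
pose a g k := `|inner g (phi k)| ^+ 2.
have a0 g k : 0 <= a g k by rewrite sqr_ge0.
have bes g J : partial_sum (a g) J <= B * rinner g g.
  rewrite -hnorm_sqr -lee_fin (le_trans _ (frB g))// esum_partial_sum//.
  by apply: ereal_sup_ubound; exists J.
have [l al] : exists l : R, partial_sum (a f) @ totally --> l.
  have : (\esum_(k in [set: I]) (a f k)%:E)%E \is a fin_num.
    rewrite ge0_fin_numE; last by apply: esum_ge0 => k _; rewrite lee_fin.
    exact: le_lt_trans (frB f) (ltry _).
  move=> /fineK/esym/(esum_cvg_partial_sum (a0 f)).
  by exists (fine (esum setT (fun k => (a f k)%:E))).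
pose x k : realified V := inner f (phi k) *: phi k.
suff : cvg (partial_sum x @ totally) by [].
apply: hcauchy_cvg; apply: cauchy_exP => e e0.
(* Two coefficient sums this close to their limit differ by less than e^2 / B, so the synthesis
   bound makes the difference of the vector sums shorter than e. *)
have d0 : 0 < e ^+ 2 / B / 2 by rewrite !divr_gt0// exprn_gt0.
have /cvgrPdist_lt/(_ _ d0)[A _ AJ] := al.
exists (partial_sum x A), A => // J /= AJs.
rewrite -ball_normE /= distrC.
have -> : partial_sum x J - partial_sum x A = partial_sum x (J `\` A)%fset.
  by rewrite (partial_sum_split _ AJs) addrC addKr.
rewrite norm_realified -ltr_sqr ?nnegrE ?hnorm_ge0 ?(ltW e0)//.
apply: le_lt_trans
  (bessel_partial_sum (fun k => inner f (phi k)) B0 (fun g => bes g _)) _.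
rewrite -ltr_pdivlMl// mulrC.
have := partial_sum_split (a f) AJs.
have := AJ _ (fsubset_refl A); have := AJ _ AJs.
by rewrite /= !ltr_norml => /andP[? ?] /andP[? ?]; rewrite -/(a f); lra.
Qed.

Hypothesis frame_phi : frame phi.

Lemma frame_operator_inner f h :
  partial_sum (fun k => inner f (phi k) * inner (phi k) h) @ totally
    --> inner (frame_operator phi f) h.
Proof.
have [A [B [_ B0 frB]]] := frame_phi.
have -> : (fun k => inner f (phi k) * inner (phi k) h) =
          (fun k => inner (inner f (phi k) *: phi k) h).
  by apply/funext => k; rewrite innerZl.
have frB' g : (\esum_(k in [set: I]) (`|inner g (phi k)| ^+ 2)%:E <=
  (B * hnorm g ^+ 2)%:E)%E by case/andP: (frB g).
exact: (cvg_inner (h := h) (frame_operator_cvg (f := f) B0 frB')).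
Qed.

Lemma frame_operator_rinner f h :
  partial_sum (fun k => qre (inner f (phi k) * inner (phi k) h)) @ totally
    --> rinner (frame_operator phi f) h.
Proof.
exact: (cvg_qre (@frame_operator_inner f h)).
Qed.

Lemma inner_frame_operatorC f h :
  inner (frame_operator phi f) h = inner f (frame_operator phi h).
Proof.
rewrite -[RHS]conj_inner.
apply: (norm_cvg_unique (@frame_operator_inner f h)).
have -> : (fun k => inner f (phi k) * inner (phi k) h) =
    (fun k => quat_conj (inner h (phi k) * inner (phi k) f)).
  by apply/funext => k; rewrite quat_conjM !conj_inner.
exact: (cvg_quat_conj (@frame_operator_inner h f)).
Qed.

Lemma rsym_frame_operator : rsym (frame_operator phi).
Proof. by move=> f h; rewrite /rinner inner_frame_operatorC. Qed.

Lemma frame_operator_bounds : exists A B : R, [/\ 0 < A, 0 < B & forall f,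
  A * rinner f f <= rinner (frame_operator phi f) f <= B * rinner f f].
Proof.
have [A [B [A0 B0 frAB]]] := frame_phi; exists A, B; split=> // f.
have := frAB f; rewrite hnorm_sqr.
rewrite (@cvg_partial_sum_esum _ _ _ (rinner (frame_operator phi f) f)) ?lee_fin//.
have -> : (fun k => `|inner f (phi k)| ^+ 2) =
          (fun k => qre (inner f (phi k) * inner (phi k) f)).
  by apply/funext => k; rewrite -(conj_inner f) qreM_conj.
exact: frame_operator_rinner.
Qed.

End FrameOperator.

(** * Polarization of the controlled sums *)

Section ControlledForm.
Variables (R : realType) (V : quatHilbertType R) (I : countType) (phi : I -> V).
Variables (C : {linear V -> V}) (r : V -> R).
Hypothesis saC : self_adjoint C.
Hypothesis rP : forall f,
  partial_sum (fun k => inner f (phi k) * inner (C (phi k)) f) @ totally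
    --> realq (r f).
Implicit Types f g h : V.

(* Polarizing with [f + g] gives the symmetric part of the form; its
   antisymmetric part is the i-component of the polarization with [f + i g],
   which vanishes because the sums on the diagonal are real. *)
Lemma controlled_form_cvg g f :
  partial_sum (fun k => qre (inner g (phi k) * inner (phi k) (C f))) @ totally
    --> 2^-1 * (r (f + g) - r f - r g).
Proof.
pose P f k := inner f (phi k) * inner (phi k) (C f).
have cvgP h : partial_sum (P h) @ totally --> realq (r h).
  have -> : P h = (fun k => inner h (phi k) * inner (C (phi k)) h).
    by apply/funext => k; rewrite /P saC.
  exact: rP.
have cvg_re h : partial_sum (fun k => qre (P h k)) @ totally --> r h.
  exact: (cvg_qre (cvgP h)).
have cvg_i h : partial_sum (fun k => qi (P h k)) @ totally --> (0 : R).
  exact: (cvg_qi (cvgP h)).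
pose ig := Quat 0 1 0 0 *: g.
have -> : (fun k => qre (inner g (phi k) * inner (phi k) (C f))) = (fun k =>
    2^-1 * (qre (P (f + g) k) - qre (P f k) - qre (P g k))
  + 2^-1 * (qi (P (f + ig) k) - qi (P f k) - qi (P ig k))).
  apply/funext => k; rewrite /P /ig !linearD !linearZ/= !(innerDl, innerDr).
  rewrite !innerZl !innerZr.
  case: (inner f _) (inner g _) (inner _ (C f)) (inner _ (C g)).
  by move=> ? ? ? ? [? ? ? ?] [? ? ? ?] [? ? ? ?] /=; field.
(* The added zeros are the limits of the three sums of i-components. *)
have -> : 2^-1 * (r (f + g) - r f - r g) =
    2^-1 * (r (f + g) - r f - r g) + 2^-1 * (0 - 0 - 0) by ring.
have h1 := cvg_partial_sumB (cvg_partial_sumB (@cvg_re (f + g)) (@cvg_re f)) (@cvg_re g).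
have h2 := cvg_partial_sumB (cvg_partial_sumB (@cvg_i (f + ig)) (@cvg_i f)) (@cvg_i ig).
exact: cvg_partial_sumD (cvg_partial_sumZ (c := 2^-1) h1)
                        (cvg_partial_sumZ (c := 2^-1) h2).
Qed.

End ControlledForm.

Lemma qre_inner_sqr (R : realType) (V : quatInnerType R) (f g : V) :
  qre (inner f g * inner g f) = `|inner f g| ^+ 2.
Proof. by rewrite -(conj_inner f g) qreM_conj. Qed.

(** * The two implications *)

Section ControlledFrame.
Variables (R : realType) (V : quatHilbertType R) (I : countType) (phi : I -> V).
Variables (C : {linear V -> V}).
Hypotheses (GLC : GL C) (saC : self_adjoint C).
Implicit Types f g h : V.

Lemma rsym_self_adjoint : rsym C.
Proof. by move=> f g; rewrite /rinner saC. Qed.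

(** Both signs come from |C f + f|^2 >= 0 and |C f - f|^2 >= 0. *)
Lemma rinner_le_bounded (M : R) f : (forall g, rinner (C g) (C g) <= M * rinner g g) ->
  `|rinner (C f) f| <= (M + 1) / 2 * rinner f f.
Proof.
move=> CM; have := CM f.
have := rinner_ge0 (C f + f); have := rinner_ge0 (C f - f).
rewrite !(rinnerDl, rinnerDr, rinnerNl, rinnerNr) (rinnerC f (C f)) => ? ? ?.
by rewrite ler_norml; apply/andP; split; lra.
Qed.

Lemma positive_op_rinner : (forall f, 0 <= rinner (C f) f) -> positive_op C.
Proof.
move=> C0 f; exists (rinner (C f) f) => //.
by apply: quat_conj_real; rewrite conj_inner saC.
Qed.

Lemma controlled_frame_of_frame : frame phi -> positive_op C ->
  (forall f, C (frame_operator phi f) = frame_operator phi (C f)) ->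
  controlled_frame phi C.
Proof.
move=> frphi posC CS.
have [bC [C' [CK _ bC']]] := GLC.
have [M M0 CM] := bounded_op_sqr bC; have [M' M'0 C'M] := bounded_op_sqr bC'.
have [a [b [a0 b0 Sab]]] := frame_operator_bounds frphi.
have sC := rsym_self_adjoint; have sS := rsym_frame_operator frphi.
pose N := (M + 1) / 2.
have N0 : 0 < N by rewrite /N; lra.
have C0 f : 0 <= rinner (C f) f by have [c c0 e] := posC f; rewrite /rinner e.
have CN f : 0 <= rinner (C f) f <= N * rinner f f.
  by rewrite C0 (le_trans (ler_norm _))// rinner_le_bounded.
have S0b f : 0 <= rinner (frame_operator phi f) f <= b * rinner f f.
  have /andP[Sa ->] := Sab f; rewrite andbT (le_trans _ Sa)//.
  by rewrite mulr_ge0 ?rinner_ge0 ?ltW.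
(* The chain is <S C f|f> >= a <C f|f> together with |f|^2 = |C' C f|^2 <= M' |C f|^2 <= M' N <C
   f|f>. *)
pose A := a / (M' * N).
have A0 : 0 < A by rewrite divr_gt0// mulr_gt0.
(* The upper constant comes from 2 <S f|C f> <= |S f|^2 + |C f|^2; the maximum secures the order of
   the two constants. *)
exists A, (Num.max A ((b ^+ 2 + M) / 2)); split=> //; first by rewrite le_max lexx.
move=> f; exists (rinner (frame_operator phi f) (C f)); split.
  have -> : (fun k => inner f (phi k) * inner (C (phi k)) f) =
            (fun k => inner f (phi k) * inner (phi k) (C f)).
    by apply/funext => k; rewrite saC.
  (* The limit <S f|C f> is real since C S = S C makes it equal to its conjugate. *)
  rewrite /rinner -quat_conj_real; first exact: frame_operator_inner.
  by rewrite conj_inner inner_frame_operatorC// -CS -saC.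
rewrite hnorm_sqr; apply/andP; split.
  have Sa g : a * rinner g g <= rinner (frame_operator phi g) g.
    by case/andP: (Sab g).
  rewrite sS rinnerC (le_trans _ (mul_rge sC sS N0 CN Sa (fun g => esym (CS g)) f))//.
  rewrite /A -mulrA ler_pM2l// ler_pdivrMl ?(mulr_gt0 M'0 N0)//.
  rewrite -{1 2}(CK f) (le_trans (C'M _))// -mulrA ler_pM2l//.
  exact: rsym_sqr_le.
apply: (@le_trans _ _ ((b ^+ 2 + M) / 2 * rinner f f)); last first.
  by rewrite ler_wpM2r ?rinner_ge0// le_max lexx orbT.
have SS : rinner (frame_operator phi f) (frame_operator phi f) <= b ^+ 2 * rinner f f.
  rewrite (le_trans (rsym_sqr_le _ sS b0 S0b))// expr2 -mulrA ler_pM2l//.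
  by case/andP: (Sab f).
have := CM f; have := rinner_ge0 (frame_operator phi f - C f).
rewrite !(rinnerDl, rinnerDr, rinnerNl, rinnerNr).
rewrite [rinner (C f) (frame_operator _ _)]rinnerC.
lra.
Qed.

Lemma frame_of_controlled_frame : controlled_frame phi C ->
  [/\ frame phi, positive_op C &
      forall f, C (frame_operator phi f) = frame_operator phi (C f)].
Proof.
move=> [A [B [A0 AB /choice[r rP]]]].
have [bC [C' [CK C'K bC']]] := GLC.
have [M M0 CM] := bounded_op_sqr bC; have [M' M'0 C'M] := bounded_op_sqr bC'.
have B0 : 0 < B := lt_le_trans A0 AB.
have cvgr f := (rP f).1.
have rA f : A * rinner f f <= r f by have [_ /andP[+ _]] := rP f; rewrite hnorm_sqr.
have rB f : r f <= B * rinner f f by have [_ /andP[_]] := rP f; rewrite hnorm_sqr.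
pose t f h k := qre (inner f (phi k) * inner (phi k) h).
(* Polarization with C' h in place of h removes [C] from the form, since C C' h = h. *)
pose T f h := 2^-1 * (r (C' h + f) - r (C' h) - r f).
have tT f h : partial_sum (t f h) @ totally --> T f h.
  by rewrite /t -{1}(C'K h); exact: controlled_form_cvg.
have TC f h : T f h = T h f.
  apply: (cvg_partial_sum_unique (tT f h)).
  have -> : t f h = t h f; last exact: tT.
  apply/funext => k; rewrite /t -(conj_inner h) -(conj_inner f).
  exact: qreM_conjC.
have TCC f h : T f (C h) = T h (C f) by rewrite /T !CK [h + f]addrC; ring.
have Tr f : T f (C f) = r f.
  apply: (cvg_partial_sum_unique (tT f (C f))).
  have -> : t f (C f) = (fun k => qre (inner f (phi k) * inner (C (phi k)) f)).
    by apply/funext => k; rewrite /t saC.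
  exact: (cvg_qre (cvgr f)).
have t0 f k : 0 <= t f f k by rewrite /t qre_inner_sqr sqr_ge0.
(* Dropping the negative terms of T(f, f) leaves r (C' f + f) / 2 <= B (|C' f|^2 + |f|^2). *)
pose B1 := B * (M' + 1).
have B10 : 0 < B1 by rewrite mulr_gt0// addr_gt0.
have Tub f : T f f <= B1 * rinner f f.
  have r0 g : 0 <= r g by rewrite (le_trans _ (rA g))// mulr_ge0 ?rinner_ge0 ?ltW.
  apply: (@le_trans _ _ (2^-1 * r (C' f + f))).
    by rewrite /T; have := r0 f; have := r0 (C' f); lra.
  rewrite ler_pdivrMl// (le_trans (rB _))// /B1 -mulrA [leRHS]mulrCA ler_pM2l//.
  have := C'M f; have := rinner_ge0 (C' f - f).
  rewrite !(rinnerDl, rinnerDr, rinnerNl, rinnerNr) [rinner (C' f) f]rinnerC.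
  lra.
have T_amgm f h (s : R) : 0 < s -> 2 * T f h <= s * T f f + s^-1 * T h h.
  move=> s0.
  have := cvg_partial_sumB
    (cvg_partial_sumD (cvg_partial_sumZ (c := s) (tT f f))
                      (cvg_partial_sumZ (c := s^-1) (tT h h)))
    (cvg_partial_sumZ (c := 2) (tT f h)).
  rewrite -subr_ge0; apply: cvg_partial_sum_ge0 => k.
  by rewrite /t !qre_inner_sqr -(conj_inner h) subr_ge0 qreM_conj_le.
(* This weight makes s^-1 T(C f, C f) at most A |f|^2, so half of 2 A |f|^2 <= 2 T(f, C f) is
   absorbed and A |f|^2 <= s T(f, f) remains. *)
pose s := B1 * M / A.
have s0 : 0 < s by rewrite divr_gt0// mulr_gt0.
have Tlb f : A / s * rinner f f <= T f f.
  have := T_amgm f (C f) s s0; rewrite Tr => h.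
  have : s^-1 * T (C f) (C f) <= A * rinner f f.
    rewrite ler_pdivrMl// /s mulrA divfK ?gt_eqF//.
    by rewrite (le_trans (Tub _))// -[leRHS]mulrA ler_pM2l.
  by rewrite mulrAC ler_pdivrMr//; have := rA f; lra.
have frphi : frame phi.
  exists (A / s), B1; split=> // [|f]; first exact: divr_gt0.
  rewrite hnorm_sqr (_ : (fun k => _) = (fun k => (t f f k)%:E)).
    by rewrite (cvg_partial_sum_esum (t0 f) (tT f f)) !lee_fin Tlb Tub.
  by apply/funext => k; rewrite /t qre_inner_sqr.
have TS f h : T f h = rinner (frame_operator phi f) h.
  exact: (cvg_partial_sum_unique (tT f h) (@frame_operator_rinner _ _ _ _ frphi f h)).
have sC := rsym_self_adjoint; have sS := rsym_frame_operator frphi.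
have CS f : C (frame_operator phi f) = frame_operator phi (C f).
  (* <C S f|h> = T(f, C h) = T(h, C f) = T(C f, h) = <S C f|h> in real parts. *)
  by apply: rinner_ext => h; rewrite sC -!TS TCC TC.
split=> //; apply: positive_op_rinner.
have Sab f : A / s * rinner f f <= rinner (frame_operator phi f) f <= B1 * rinner f f.
  by rewrite -TS Tlb Tub.
apply: (rpos_of_mul (M := (M + 1) / 2) sC sS _ B10 _ Sab _ CS).
- exact: divr_gt0.
- lra.
- move=> g; have := rinner_le_bounded g CM.
  by rewrite ler_norml mulNr => /andP[].
(* The form of C S on the diagonal is the controlled sum r g itself. *)
- by move=> g; rewrite sC -TS Tr (le_trans _ (rA g))// mulr_ge0 ?rinner_ge0// ltW.
Qed.

End ControlledFrame.

Theorem proposition3p3 (R : realType) (V : quatHilbertType R)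
    (sepV : separable (realified V)) (C : {linear V -> V}) (GLC : GL C)
    (saC : self_adjoint C) (I : countType) (phi : I -> V) :
  controlled_frame phi C <->
  [/\ frame phi, positive_op C &
      forall psi : V, C (frame_operator phi psi) = frame_operator phi (C psi)].
Proof.
split; first exact: frame_of_controlled_frame.
by case; exact: controlled_frame_of_frame.
Qed.
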